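(* For every integer $n\ge1$, the square-root gauge $A_{\mathrm{sym}}$ of the symmetric Ehrenfest chain on $\{0,\dots,n\}$ with uniformisation rate $\Lambda=n$ satisfies $$A_{\mathrm{sym}}=\frac2n\,J_x,$$ where $J_x$ is the spin-$\tfrac n2$ matrix, indexed by $k=m+\tfrac n2$.
   Context: The symmetric Ehrenfest urn with $n$ balls is the continuous-time Markov chain on $\{0,\dots,n\}$ with generator $Q_{k,k-1}=k$, $Q_{k,k+1}=n-k$, $Q_{kk}=-n$, all other entries zero. It is reversible with respect to $\nu_k=2^{-n}\binom nk$. With $\Lambda=n$ set $P=\mathrm{I}+\tfrac1n Q$, $D=\mathrm{diag}(\sqrt{\nu_0},\dots,\sqrt{\nu_n})$, and $A_{\mathrm{sym}}:=DPD^{-1}$. For spin $j=\tfrac n2$, with basis labelled by $m\in\{-j,-j+1,\dots,j\}$ ($m$ the eigenvalue of the diagonal matrix $J_z$), $J_x$ is the real symmetric tridiagonal $(2j+1)\times(2j+1)$ matrix with zero diagonal whose off-diagonal entry between $m$ and $m+1$ is $\tfrac12\sqrt{(j-m)(j+m+1)}$. *)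

(* Defs.v *)
From mathcomp Require Import all_boot all_order all_algebra.

Set Implicit Arguments.
Unset Strict Implicit.
Unset Printing Implicit Defensive.

Import Order.TTheory GRing.Theory Num.Theory.
Local Open Scope ring_scope.

Section Chains.
Variable R : rcfType.

Definition uniformised (n : nat) (Lambda : R) (Q : 'M[R]_n.+1) : 'M[R]_n.+1 :=
  1%:M + Lambda^-1 *: Q.

Definition sqrt_diag (n : nat) (nu : 'I_n.+1 -> R) : 'M[R]_n.+1 :=
  diag_mx (\row_k Num.sqrt (nu k)).

(* [invmx] is the genuine inverse only when [nu] is everywhere positive;
   otherwise it returns its argument. *)
Definition sqrt_gauge (n : nat) (Lambda : R) (Q : 'M[R]_n.+1)
    (nu : 'I_n.+1 -> R) : 'M[R]_n.+1 :=
  sqrt_diag nu *m uniformised Lambda Q *m invmx (sqrt_diag nu).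

Definition ehrenfest_gen (n : nat) : 'M[R]_n.+1 :=
  \matrix_(k, l)
    if (l.+1 == k)%N then k%:R
    else if (l == k.+1 :> nat) then n%:R - k%:R
    else if k == l then - n%:R
    else 0.

Definition ehrenfest_nu (n : nat) (k : 'I_n.+1) : R :=
  2 ^- n * 'C(n, k)%:R.

End Chains.

Section Spin.
Variable R : rcfType.

Definition spin_offdiag (j m : R) : R :=
  2^-1 * Num.sqrt ((j - m) * (j + m + 1)).

Definition Jx_entry (j m m' : R) : R :=
  if m' == m + 1 then spin_offdiag j m
  else if m == m' + 1 then spin_offdiag j m'
  else 0.

Definition spin_of (n : nat) : R := n%:R / 2.

(* The J_z-eigenvalue m attached to the index k = m + n/2. *)
Definition spin_label (n : nat) (k : 'I_n.+1) : R := k%:R - spin_of n.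

Definition spin_Jx (n : nat) : 'M[R]_n.+1 :=
  \matrix_(k, l) Jx_entry (spin_of n) (spin_label k) (spin_label l).

End Spin.

Arguments ehrenfest_gen R n : clear implicits.
Arguments ehrenfest_nu R n k : clear implicits.
Arguments spin_of R n : clear implicits.
Arguments spin_label R {n} k.
Arguments spin_Jx R n : clear implicits.

(* Main.v *)
Require Import Defs.
From mathcomp Require Import all_boot all_order all_algebra.
From mathcomp Require Import ring.
Import Order.TTheory GRing.Theory Num.Theory.
Local Open Scope ring_scope.

(** Write [D] for the diagonal matrix of the square roots of the stationary
    weights.  Since the weights are positive, [D] is invertible, and the claim
    [D P D^-1 = S], where [S] is the rescaled spin matrix, is equivalent to
    the entrywise identity [D P = S D], which involves no inverse.

    Uniformising at rate [n] cancels the diagonal of the generator, so both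
    sides are supported on neighbouring indices.  On such an edge everything
    comes from detailed balance, [nu_k (n - k) = nu_(k+1) (k+1)]: for a chain
    reversible with respect to [nu], with rates [a] from [x] to [y] and [b]
    back, conjugating by the square roots of the weights replaces both rates by
    their geometric mean [sqrt (a b)] ([sqrt_weight_rate]).  Here this mean is
    [sqrt ((n - k) (k + 1))], which is [sqrt ((j - m) (j + m + 1))] after the
    substitution [j = n/2], [m = k - n/2] ([spin_JxE]); the factor 1/2 in the
    spin matrix is compensated by the 2 in the scaling. *)

(** Detailed balance [x a = y b] turns the rate [a] into the geometric mean of
    the two rates, because [a b y = a^2 x]. *)
Lemma sqrt_weight_rate (R : rcfType) (x y a b : R) :
  0 <= a -> 0 <= b -> x * a = y * b ->
  Num.sqrt x * a = Num.sqrt (a * b) * Num.sqrt y.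
Proof.
move=> a_ge0 b_ge0 balance.
have abyE : a * b * y = a ^+ 2 * x by rewrite -mulrA (mulrC b) -balance; ring.
rewrite -sqrtrM ?mulr_ge0 // abyE sqrtrM ?sqr_ge0 //.
by rewrite sqrtr_sqr ger0_norm // mulrC.
Qed.

Lemma ehrenfest_nu_gt0 (R : rcfType) (n : nat) (k : 'I_n.+1) :
  0 < ehrenfest_nu R n k.
Proof.
by rewrite mulr_gt0 ?invr_gt0 ?exprn_gt0 // ltr0n bin_gt0 -ltnS ltn_ord.
Qed.

(** Up to the common factor [2 ^- n], this is the absorption identity
    [(k+1) C(n, k+1) = (n - k) C(n, k)]. *)
Lemma ehrenfest_detailed_balance (R : rcfType) (n : nat) (k l : 'I_n.+1) :
  l = k.+1 :> nat ->
  ehrenfest_nu R n k * (n%:R - k%:R) = ehrenfest_nu R n l * k.+1%:R.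
Proof.
move=> lE; rewrite /ehrenfest_nu lE -!mulrA -natrB ?leq_ord // -!natrM.
by rewrite [in RHS]mulnC mul_bin_left mulnC.
Qed.

Lemma sqrt_diag_unit (R : rcfType) (n : nat) (nu : 'I_n.+1 -> R) :
  (forall k, 0 < nu k) -> sqrt_diag nu \in unitmx.
Proof.
move=> nu_gt0; rewrite unitmxE det_diag unitfE prodf_seq_neq0.
by apply/allP=> k _; rewrite mxE gt_eqF ?sqrtr_gt0.
Qed.

Lemma spin_labelS (R : rcfType) (n : nat) (k l : 'I_n.+1) :
  (spin_label R l == spin_label R k + 1) = (l == k.+1 :> nat).
Proof.
by rewrite /spin_label addrAC (inj_eq (addIr _)) natr1 eqr_nat.
Qed.

Lemma spin_offdiag_label (R : rcfType) (n : nat) (k : 'I_n.+1) :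
  spin_offdiag (spin_of R n) (spin_label R k) =
  2^-1 * Num.sqrt ((n%:R - k%:R) * k.+1%:R).
Proof.
rewrite /spin_offdiag /spin_label /spin_of -natr1.
by congr (_ * Num.sqrt (_ * _)); field.
Qed.

Lemma spin_JxE (R : rcfType) (n : nat) (k l : 'I_n.+1) :
  spin_Jx R n k l =
  if l == k.+1 :> nat then 2^-1 * Num.sqrt ((n%:R - k%:R) * k.+1%:R)
  else if k == l.+1 :> nat then 2^-1 * Num.sqrt ((n%:R - l%:R) * l.+1%:R)
  else 0.
Proof. by rewrite mxE /Jx_entry !spin_labelS !spin_offdiag_label. Qed.

(** The diagonal entries are [1 - n / n = 0]: with this rate the uniformised
    chain never stays put. *)
Lemma uniformised_ehrenfestE (R : rcfType) (n : nat) (k l : 'I_n.+1) :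
  (0 < n)%N ->
  uniformised n%:R (ehrenfest_gen R n) k l =
  n%:R^-1 * (if l == k.+1 :> nat then n%:R - k%:R
             else if k == l.+1 :> nat then k%:R else 0).
Proof.
move=> n_gt0; rewrite !mxE [(l.+1 == k)%N]eq_sym -val_eqE /=.
case: (eqVneq (k : nat) l.+1) => [-> | _].
  by rewrite gtn_eqF ?ltn_eqF ?add0r ?ltnS ?leqnSn.
case: (eqVneq (l : nat) k.+1) => [-> | _]; first by rewrite ltn_eqF ?add0r.
case: (eqVneq (k : nat) l) => _; last by rewrite add0r.
by rewrite mulrN mulVf ?pnatr_eq0 -?lt0n // subrr mulr0.
Qed.

Theorem lemma7p4 (R : rcfType) (n : nat) (hn : (1 <= n)%N) :
  sqrt_gauge n%:R (ehrenfest_gen R n) (ehrenfest_nu R n)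
  = (2 / n%:R) *: spin_Jx R n.
Proof.
have D_unit := sqrt_diag_unit R n _ (ehrenfest_nu_gt0 R n).
have half2 : (2 : R) / n%:R * 2^-1 = n%:R^-1.
  by rewrite mulrAC mulfV ?mul1r // pnatr_eq0.
have subr_nat_ge0 (k : 'I_n.+1) : 0 <= n%:R - k%:R :> R.
  by rewrite subr_ge0 ler_nat leq_ord.
apply: (canLR (mulmxK D_unit)); apply/matrixP=> k l.
rewrite mul_diag_mx mul_mx_diag ![(\matrix_(_, _) _) _ _]mxE.
rewrite uniformised_ehrenfestE // [((_ *: _ : 'M_n.+1) _ _)]mxE spin_JxE mulrCA.
case: eqVneq => [lE | _].
  rewrite (mulrA (2 / _)) half2 -mulrA; congr (_ * _).
  by apply: sqrt_weight_rate => //; apply: ehrenfest_detailed_balance.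
case: eqVneq => [kE | _]; last by rewrite !(mulr0, mul0r).
(* The same edge traversed downwards: the two rates exchange roles, and detailed
   balance is read from right to left. *)
rewrite (mulrA (2 / _)) half2 -mulrA; congr (_ * _).
rewrite {1}kE [X in _ = Num.sqrt X * _]mulrC.
by apply: sqrt_weight_rate => //; rewrite -ehrenfest_detailed_balance.
Qed.
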